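(* There exists a $3$-way $4$-homogeneous $(v,3,2)$ Steiner trade if and only if $v\ge 9$ and $v\equiv 0\pmod 3$.
   Context: Let $V$ be a finite set with $v$ elements and let $t<k<v$ be positive integers. A $\mu$-way $(v,k,t)$ trade $T=\{T_1,\dots,T_\mu\}$ of volume $m$ consists of $\mu$ pairwise disjoint collections $T_1,\dots,T_\mu$, each of $m$ blocks ($k$-subsets of $V$), such that every $t$-subset of $V$ is contained in the same number of blocks in each $T_i$. The foundation $\mathrm{found}(T)$ is the set of elements covered by the blocks. It is a Steiner trade if every $t$-subset of $\mathrm{found}(T)$ is in at most one block of each $T_i$, and $d$-homogeneous if every element of $V$ lies in exactly $d$ blocks of each $T_i$. *)

(* Defs.v *)
From mathcomp Require Import all_boot.

Set Implicit Arguments.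
Unset Strict Implicit.
Unset Printing Implicit Defensive.

(* Number of blocks of the collection [C] that contain [S]. *)
Definition blocks_through (V : finType) (C : {set {set V}}) (S : {set V}) : nat :=
  #|[set B in C | S \subset B]|.

(* A [mu]-way [(v, k, t)] trade of volume [m] on the point set [V], v = #|V|.
   A collection of blocks is a set of blocks: in a Steiner trade with t < k no
   block can be repeated, so multisets would give nothing more there. *)
Definition is_trade (V : finType) (mu k t m : nat)
    (T : 'I_mu -> {set {set V}}) : Prop :=
  [/\ [/\ 0 < t, t < k & k < #|V|],
      forall i j : 'I_mu, i != j -> [disjoint T i & T j],
      forall i : 'I_mu, #|T i| = m,
      forall (i : 'I_mu) (B : {set V}), B \in T i -> #|B| = k
    & forall S : {set V}, #|S| = t ->
        forall i j : 'I_mu, blocks_through (T i) S = blocks_through (T j) S].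

Definition found (V : finType) (mu : nat) (T : 'I_mu -> {set {set V}}) : {set V} :=
  \bigcup_(i < mu) cover (T i).

Definition is_steiner (V : finType) (mu t : nat) (T : 'I_mu -> {set {set V}}) : Prop :=
  forall S : {set V}, S \subset found T -> #|S| = t ->
    forall i : 'I_mu, blocks_through (T i) S <= 1.

Definition is_homogeneous (V : finType) (mu d : nat)
    (T : 'I_mu -> {set {set V}}) : Prop :=
  forall (x : V) (i : 'I_mu), #|[set B in T i | x \in B]| = d.

(* Main.v *)
(** Double counting incidences gives [3 * m = 4 * v], and the eight neighbours
    of a point are distinct, so [v] is a multiple of [3] with [9 <= v].
    Conversely, disjoint unions of trades are trades, so it suffices to treat
    [v = 9, 12, 15]: three disjoint Steiner triple systems of order 9, three
    disjoint Latin squares of order 4, and three idempotent Latin squares of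
    order 5 that are disjoint off their (deleted) common diagonal. *)
Require Import Defs.
From mathcomp Require Import all_boot.
From mathcomp Require Import zify.

Set Implicit Arguments.
Unset Strict Implicit.
Unset Printing Implicit Defensive.

(** * Necessity: double counting of incidences *)

Lemma sum_blocks_through_point (V : finType) (C : {set {set V}}) :
  \sum_x #|[set B in C | x \in B]| = \sum_(B in C) #|B|.
Proof.
transitivity (\sum_x \sum_(B in C) (x \in B : nat)).
  apply: eq_bigr => x _; rewrite -sum1_card [RHS]big_mkcond [LHS]big_mkcond /=.
  by apply: eq_bigr => B _; rewrite inE; case: (B \in C); case: (x \in B).
rewrite exchange_big /=; apply: eq_bigr => B _.
by rewrite -sum1_card [RHS]big_mkcond; apply: eq_bigr => x _; case: (x \in B).
Qed.

(** Both sides count the incident pairs of a point and a block. *)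
Lemma homogeneous_volume (V : finType) (C : {set {set V}}) k d :
    (forall B, B \in C -> #|B| = k) ->
    (forall x, #|[set B in C | x \in B]| = d) ->
  #|C| * k = #|V| * d.
Proof.
move=> Ck Cd; rewrite -sum_nat_const -(eq_bigr _ Ck) -sum_blocks_through_point.
by rewrite (eq_bigr (fun=> d)) // big_const iter_addn_0 mulnC.
Qed.

(** The [d] blocks through [x] have total size [d * k]. In this total [x] is counted at most [d]
    times, and each of the other [#|V|.-1] points at most once, since it shares at most one block
    with [x]. *)
Lemma steiner_neighbours (V : finType) (C : {set {set V}}) k d (x : V) :
    (forall B, B \in C -> #|B| = k) ->
    (forall y, y != x -> blocks_through C [set x; y] <= 1) ->
    #|[set B in C | x \in B]| = d ->
  d * k <= d + #|V|.-1.
Proof.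
set Cx := [set B in C | x \in B] => Ck C1 Cxd.
have: \sum_y #|[set B in Cx | y \in B]| = d * k.
  rewrite sum_blocks_through_point (eq_bigr (fun=> k)) ?sum_nat_const ?Cxd //.
  by move=> B; rewrite inE => /andP[/Ck].
move=> <-; rewrite (bigD1 x) //=; apply: leq_add.
  by rewrite -Cxd; apply/subset_leq_card/subsetP => B; rewrite inE => /andP[].
rewrite -(cardC1 x) -sum1_card; apply: leq_sum => y /C1; congr (_ <= _).
by apply: eq_card => B; rewrite !inE subUset !sub1set andbA.
Qed.

Lemma homogeneous_trade_order (V : finType) (m : nat)
    (T : 'I_3 -> {set {set V}}) :
    is_trade 3 2 m T -> is_steiner 2 T -> is_homogeneous 4 T ->
  9 <= #|V| /\ #|V| = 0 %[mod 3].
Proof.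
move=> [[_ _ V3] _ _ T3 _] Tsteiner Thom.
have /card_gt0P[x _] := leq_ltn_trans (leq0n 3) V3.
(* Every point lies in four blocks, so the foundation is all of [V] and the Steiner condition
   reaches every pair. *)
have foundT y : y \in found T.
  have /card_gt0P[B] : 0 < #|[set B in T ord0 | y \in B]| by rewrite Thom.
  rewrite inE => /andP[BT yB].
  by apply/bigcupP; exists ord0 => //; apply/bigcupP; exists B.
have T1 y : y != x -> blocks_through (T ord0) [set x; y] <= 1.
  move=> yx; apply: Tsteiner; last by rewrite cards2 eq_sym yx.
  by apply/subsetP => z _; apply: foundT.
(* The two facts read [12 <= 4 + (v - 1)] and [3 * m = 4 * v]; the second forces [3] to divide
   [v]. *)
have := steiner_neighbours (T3 ord0) T1 (Thom x ord0).
by have := homogeneous_volume (T3 ord0) (Thom^~ ord0); lia.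
Qed.

(** * Trades on initial segments of the natural numbers and their disjoint sums *)

(* Blocks are listed in increasing order, so that distinct lists denote distinct
   blocks. *)
Record nat_trade (n : nat) (C : nat -> seq (seq nat)) : Prop := NatTrade {
  nat_trade_block : forall i s, i < 3 -> s \in C i ->
    [&& sorted ltn s, size s == 3 & all (gtn n) s];
  nat_trade_uniq : forall i, i < 3 -> uniq (C i);
  nat_trade_disjoint : forall i j s, i < 3 -> j < 3 ->
    s \in C i -> s \in C j -> i = j;
  nat_trade_point : forall i x, i < 3 -> x < n ->
    count (fun s => x \in s) (C i) = 4;
  nat_trade_pair : forall i x y, i < 3 -> x < n -> y < n -> x != y ->
    let c j := count (fun s => (x \in s) && (y \in s)) (C j) in
    c i = c 0 /\ c i <= 1 }.

(** A decision procedure, so that concrete trades are checked by computation. *)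
Definition nat_tradeb n (C : nat -> seq (seq nat)) :=
  let pts := iota 0 n in
  [&& all (fun i =>
        all (fun s => [&& sorted ltn s, size s == 3 & all (gtn n) s]) (C i))
          (iota 0 3),
      all (fun i => uniq (C i)) (iota 0 3),
      all (fun i => all (fun j => has (mem (C i)) (C j) ==> (i == j))
          (iota 0 3)) (iota 0 3),
      all (fun i => all (fun x => count (fun s => x \in s) (C i) == 4) pts)
          (iota 0 3)
    & all (fun i => all (fun x => all (fun y => (x != y) ==>
        let c j := count (fun s => (x \in s) && (y \in s)) (C j) in
        (c i == c 0) && (c i <= 1)) pts) pts) (iota 0 3)].

Lemma nat_tradebP n C : nat_tradeb n C -> nat_trade n C.
Proof.
have io m i : i < m -> i \in iota 0 m by rewrite mem_iota.
case/and5P=> /allP Cb /allP Cu /allP Cd /allP Cx /allP Cxy; split.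
- by move=> i s /io/Cb/allP; apply.
- by move=> i /io/Cu.
- move=> i j s /io/Cd/allP Ci /io/Ci/implyP Cij si sj.
  by apply/eqP/Cij/hasP; exists s.
- by move=> i x /io/Cx/allP Ci /io/Ci/eqP.
- move=> i x y /io/Cxy/allP Ci /io/Ci/allP Cix /io/Cix/implyP Cixy /Cixy /=.
  by case/andP=> /eqP.
Qed.

Definition block_sum n (s1 s2 : seq (seq nat)) := s1 ++ map (map (addn n)) s2.

Lemma mem_map_addn n x s : (x \in map (addn n) s) = (n <= x) && (x - n \in s).
Proof.
apply/mapP/andP => [[y ys ->]|[nx xs]]; first by rewrite leq_addr addKn.
by exists (x - n); rewrite ?subnKC.
Qed.

(** Each block lies entirely below [n1] or entirely from [n1] on, so every count has a contribution
    from one summand only, and a pair with a point on each side is in no block. *)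
Lemma nat_trade_sum n1 n2 C1 C2 :
    nat_trade n1 C1 -> nat_trade n2 C2 ->
  nat_trade (n1 + n2) (fun i => block_sum n1 (C1 i) (C2 i)).
Proof.
move=> [b1 u1 d1 p1 q1] [b2 u2 d2 p2 q2].
have small i s x : i < 3 -> s \in C1 i -> x \in s -> x < n1.
  by move=> i3 /(b1 _ _ i3)/and3P[_ _ /allP]; apply.
have count1 i x (P : pred (seq nat)) : i < 3 -> n1 <= x ->
    (forall s, P s -> x \in s) -> count P (C1 i) = 0.
  move=> i3 nx Px; apply/eqP; rewrite -leqn0 leqNgt -has_count.
  apply/hasPn => s sC; apply/negP => /Px xs.
  by have := small _ _ _ i3 sC xs; rewrite ltnNge nx.
have count2 i x (P : pred (seq nat)) : x < n1 ->
    (forall s, P s -> x \in s) -> count P (map (map (addn n1)) (C2 i)) = 0.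
  move=> xn Px; apply/eqP; rewrite -leqn0 leqNgt -has_count.
  apply/hasPn => _ /mapP[s _ ->]; apply/negP => /Px.
  by rewrite mem_map_addn leqNgt xn.
have disj i j s : i < 3 -> s \in C1 i -> s \notin map (map (addn n1)) (C2 j).
  move=> i3 sC; apply/negP => /mapP[s' _ eq_s].
  (* A block has size 3, hence a first element; it would lie on both sides of [n1]. *)
  have /and3P[_] := b1 _ _ i3 sC; case: s => // x s in sC eq_s * => _ _.
  have xs : x \in x :: s by rewrite mem_head.
  have := small _ _ _ i3 sC xs.
  by rewrite {}eq_s mem_map_addn in xs; case/andP: xs => /leq_gtF->.
have map_inj : injective (map (addn n1)) by apply/inj_map/addnI.
split.
- move=> i s i3; rewrite mem_cat => /orP[sC|/mapP[{}s sC ->]].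
    case/and3P: (b1 _ _ i3 sC) => -> -> /= sn; apply: sub_all sn => x /=.
    by move=> xn; apply: ltn_addr.
  case/and3P: (b2 _ _ i3 sC) => ss /eqP sz /allP sn.
  rewrite size_map sz eqxx sorted_map (@eq_sorted _ _ ltn) ?ss /=; last first.
    by move=> x y /=; rewrite ltn_add2l.
  by rewrite all_map; apply/allP => x /sn /=; rewrite ltn_add2l.
- move=> i i3; rewrite cat_uniq u1 // map_inj_uniq // u2 // andbT /=.
  apply/hasPn => s; apply: contraL => /disj; exact.
- move=> i j s i3 j3; rewrite !mem_cat => /orP[si|si] /orP[sj|sj].
  + exact: d1 si sj.
  + by have := disj _ j _ i3 si; rewrite sj.
  + by have := disj _ i _ j3 sj; rewrite si.
  + by case/mapP: si sj => {}s si ->; rewrite (mem_map map_inj); apply: d2.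
- move=> i x i3 xn; rewrite count_cat.
  have [x1|x1] := ltnP x n1; first by rewrite p1 // (count2 _ x).
  rewrite (count1 _ x) // count_map -(p2 i (x - n1)) //; last by lia.
  by apply: eq_count => s /=; rewrite mem_map_addn x1.
- move=> i x y i3 xn yn xy /=; rewrite !count_cat.
  have [x1|x1] := ltnP x n1.
    rewrite !(count2 _ x) //; try by move=> s /andP[].
    have [y1|y1] := ltnP y n1; first by rewrite !addn0; apply: q1.
    by rewrite !(count1 _ y) // => s /andP[].
  rewrite !(count1 _ x) //; try by move=> s /andP[].
  have [y1|y1] := ltnP y n1.
    by rewrite !(count2 _ y) // => s /andP[].
  have eq_c j :
      count (fun s => (x \in s) && (y \in s)) (map (map (addn n1)) (C2 j))
      = count (fun s => (x - n1 \in s) && (y - n1 \in s)) (C2 j).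
    by rewrite count_map; apply: eq_count => s /=; rewrite !mem_map_addn x1 y1.
  by rewrite !eq_c; apply: q2; lia.
Qed.

(** * The base trades and the induction on the order *)

(* The shifts of one Steiner triple system by the cyclic permutation of
   [0, ..., 6] that fixes [7] and [8]; the base system was found by search. *)
Lemma nat_trade9 :
  let shift a x := if x < 7 then (x + a) %% 7 else x in
  let block a s := sort leq (map (shift a) s) in
  nat_trade 9 (fun a => map (block a)
    [:: [:: 0; 1; 2]; [:: 0; 3; 7]; [:: 0; 4; 6]; [:: 0; 5; 8]; [:: 1; 3; 6];
        [:: 1; 4; 5]; [:: 1; 7; 8]; [:: 2; 3; 5]; [:: 2; 4; 7]; [:: 2; 6; 8];
        [:: 3; 4; 8]; [:: 5; 6; 7]]).
Proof. by apply: nat_tradebP; vm_compute. Qed.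

(** The Latin squares [x + y + a] over Z/4, with rows, columns and symbols as three groups of four
    points. A pair from different groups is in one block, a pair within a group in none; different
    [a] put different symbols in each cell. *)
Lemma nat_trade12 :
  nat_trade 12 (fun a => [seq [:: x; 4 + y; 8 + (x + y + a) %% 4]
                         | x <- iota 0 4, y <- iota 0 4]).
Proof. by apply: nat_tradebP; vm_compute. Qed.

(* The Latin squares [b x + c y] over Z/5 with [b + c = 1], [b = 2, 3, 4]. *)
Lemma nat_trade15 :
  nat_trade 15 (fun a =>
    [seq [:: x; 5 + y; 10 + ((a + 2) * x + (4 - a) * y) %% 5]
    | x <- iota 0 5, y <- rem x (iota 0 5)]).
Proof. by apply: nat_tradebP; vm_compute. Qed.

Lemma nat_trade_exists n :
  9 <= n -> n = 0 %[mod 3] -> exists C, nat_trade n C.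
Proof.
elim/ltn_ind: n => n IHn n9 n3.
(* From 18 on, splitting off 9 points leaves at least 9; below 18 only the three base orders
   occur. *)
have [n18|n18] := leqP 18 n.
  have [||| C tC] := IHn (n - 9); [lia..|].
  by rewrite -(subnKC n9); eexists; apply: nat_trade_sum nat_trade9 tC.
have : [|| n == 9, n == 12 | n == 15] by lia.
by case/or3P=> /eqP->; eexists;
  [exact: nat_trade9 | exact: nat_trade12 | exact: nat_trade15].
Qed.

(** * Transport to an arbitrary finite set of points *)

Definition realize (V : finType) (s : seq nat) : {set V} :=
  [set x | val (enum_rank x) \in s].

Lemma realize_inj (V : finType) (s1 s2 : seq nat) :
    sorted ltn s1 -> all (gtn #|V|) s1 -> sorted ltn s2 -> all (gtn #|V|) s2 ->
  realize V s1 = realize V s2 -> s1 = s2.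
Proof.
move=> ss1 /allP s1V ss2 /allP s2V /setP eq_s.
apply: (irr_sorted_eq ltn_trans ltnn) => // k.
(* An index [k] below [#|V|] is the rank of a point, where the two sets agree; a larger one is in
   neither list. *)
have [kV|Vk] := ltnP k #|V|.
  by have := eq_s (enum_val (Ordinal kV)); rewrite !inE enum_valK.
by apply/idP/idP => [/s1V|/s2V] /=; rewrite ltnNge Vk.
Qed.

Lemma card_realize (V : finType) (s : seq nat) :
  uniq s -> all (gtn #|V|) s -> #|realize V s| = size s.
Proof.
move=> us /allP sV; rewrite cardE -(size_map (fun x => val (enum_rank x))).
apply/perm_size/uniq_perm => //.
  by rewrite map_inj_uniq ?enum_uniq // => x y /val_inj/enum_rank_inj.
move=> k; apply/mapP/idP => [[x] | ks]; first by rewrite mem_enum inE => ? ->.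
have kV := sV _ ks; exists (enum_val (Ordinal kV)); last by rewrite enum_valK.
by rewrite mem_enum inE enum_valK.
Qed.

(** Reduces the cardinalities in the definition of a trade to the list counts controlled by
    [nat_trade]. *)
Lemma card_filter_seq (T : finType) (I : Type) (f : I -> T) (s : seq I)
    (P : pred T) :
    uniq (map f s) ->
  #|[set x in [set y in map f s] | P x]| = count (preim f P) s.
Proof.
move=> us; rewrite -count_map -size_filter cardE.
apply/perm_size/uniq_perm; rewrite ?enum_uniq ?filter_uniq // => x.
by rewrite mem_enum mem_filter !inE andbC.
Qed.

Lemma realize_trade (V : finType) (C : nat -> seq (seq nat)) :
    3 < #|V| -> nat_trade #|V| C ->
  exists (m : nat) (T : 'I_3 -> {set {set V}}),
    [/\ is_trade 3 2 m T, is_steiner 2 T & is_homogeneous 4 T].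
Proof.
move=> V3 [Cb Cu Cd Cx Cxy].
pose T (i : 'I_3) := [set B in map (realize V) (C i)].
have r_inj (i j : 'I_3) s1 s2 : s1 \in C i -> s2 \in C j ->
    realize V s1 = realize V s2 -> s1 = s2.
  move=> /(Cb _ _ (ltn_ord i))/and3P[ss1 _ s1V].
  by move=> /(Cb _ _ (ltn_ord j))/and3P[ss2 _ s2V]; apply: realize_inj.
have CTu (i : 'I_3) : uniq (map (realize V) (C i)).
  by rewrite map_inj_in_uniq ?Cu // => s1 s2; apply: r_inj.
have Thom : is_homogeneous 4 T.
  move=> x i; rewrite card_filter_seq // -(Cx i (enum_rank x)) //.
  by apply: eq_count => s; rewrite /= inE.
have T3 i B : B \in T i -> #|B| = 3.
  rewrite inE => /mapP[s /(Cb _ _ (ltn_ord i))/and3P[ss /eqP s3 sV] ->].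
  by rewrite card_realize // (sorted_uniq ltn_trans ltnn).
have T2 (S : {set V}) i : #|S| = 2 ->
    blocks_through (T i) S = blocks_through (T ord0) S /\
    blocks_through (T i) S <= 1.
  move=> /eqP/cards2P[x [y [xy ->]]].
  have bT j : blocks_through (T j) [set x; y] = count (fun s =>
      (val (enum_rank x) \in s) && (val (enum_rank y) \in s)) (C j).
    rewrite /blocks_through card_filter_seq //; apply: eq_count => s /=.
    by rewrite subUset !sub1set !inE.
  rewrite !bT; apply: Cxy; rewrite ?ltn_ord //.
  by apply: contraNneq xy => /val_inj/enum_rank_inj->.
exists #|T ord0|, T; split=> // [|S _ S2 i]; last by case: (T2 S i S2).
split=> // [i j ij|i|S S2 i j]; last first.
- by have [-> _] := T2 S i S2; have [-> _] := T2 S j S2.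
(* The volumes agree because three times each of them is [#|V| * 4]. *)
- apply/eqP; rewrite -(eqn_pmul2r (isT : 0 < 3)).
  by rewrite !(homogeneous_volume (T3 _) (Thom^~ _)).
- rewrite disjoint_subset; apply/subsetP => B; rewrite !inE => /mapP[s si ->].
  apply: contra ij => /mapP[s' sj /(r_inj _ _ _ _ si sj) eq_s].
  by rewrite -eq_s in sj; apply/eqP/val_inj; apply: Cd si sj.
Qed.

Theorem theorem3p2 (v : nat) (V : finType) (hV : #|V| = v) :
  (exists (m : nat) (T : 'I_3 -> {set {set V}}),
      [/\ is_trade 3 2 m T, is_steiner 2 T & is_homogeneous 4 T])
  <-> (9 <= v /\ v = 0 %[mod 3]).
Proof.
rewrite -hV; split=> [[m [T []]]|[V9 V3]]; first exact: homogeneous_trade_order.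
have [C] := nat_trade_exists V9 V3.
by apply: realize_trade; apply: leq_trans V9.
Qed.
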